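(* Let $G$ be a semi-regular bipartite graph whose line graph $L(G)$ has at least $3$ vertices. Then $\lambda_3(L(G)) \le \frac{|V(L(G))|}{3}$.
   Context: A graph is semi-regular bipartite if it is bipartite with a bipartition $(V_1,V_2)$ such that all vertices of $V_1$ have the same degree $r_1$ and all vertices of $V_2$ have the same degree $r_2$. The line graph $L(G)$ has the edges of $G$ as vertices, two being adjacent when they share an endpoint. $\lambda_3$ denotes the third largest eigenvalue (with multiplicity) of the adjacency matrix. *)

(* Defs.v *)
From mathcomp Require Import all_boot all_order all_algebra all_field.
Set Implicit Arguments. Unset Strict Implicit. Unset Printing Implicit Defensive.
Import Order.TTheory GRing.Theory Num.Theory.
Local Open Scope ring_scope.

Definition simple_graph (T : finType) (e : rel T) : Prop :=
  symmetric e /\ irreflexive e.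

Definition nbhd (T : finType) (e : rel T) (x : T) : {set T} := [set y | e x y].
Definition deg (T : finType) (e : rel T) (x : T) : nat := #|nbhd e x|.

Definition semiregular_bipartite (T : finType) (e : rel T) : Prop :=
  exists (V1 : {set T}) (r1 r2 : nat),
    [/\ (forall x y, e x y -> (x \in V1) != (y \in V1)),
        (forall x, x \in V1 -> deg e x = r1) &
        (forall x, x \notin V1 -> deg e x = r2)].

Definition edges (T : finType) (e : rel T) : {set {set T}} :=
  [set A : {set T} | [exists x, exists y, e x y && (A == [set x; y])]].

Definition line_adj (T : finType) (e : rel T) : 'M[algC]_(#|edges e|) :=
  \matrix_(i, j)
    ((i != j) && (enum_val i :&: enum_val j != set0))%:R.

(* The spectrum (eigenvalues with multiplicity) of a square complex matrix:
   the roots, with multiplicity, of its characteristic polynomial. *)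
Definition spectrum (n : nat) (A : 'M[algC]_n) : seq algC :=
  sval (closed_field_poly_normal (char_poly A)).

(* k-th largest eigenvalue (k >= 1), with multiplicity; meaningful for
   matrices with real spectrum (e.g. real symmetric matrices). *)
Definition lambda_k (n : nat) (A : 'M[algC]_n) (k : nat) : algC :=
  nth 0 (sort (fun x y : algC => y <= x) (spectrum A)) k.-1.

(* Main.v *)
(* Let V1, V2 be the two sides, with degrees r1 >= r2, n = |V1| and m = n r1 edges.
   Two edges share at most one endpoint, so A(L(G)) + 2 I = G1 + G2, where Gi is the
   Gram matrix of the incidences between the edges and Vi. Since Gi^2 = ri Gi, the
   form of Gi is at most ri |u|^2.
   - Always G1 + G2 <= r1 + r2, and r1 + r2 - 2 <= m / 3 once n >= 3 and r2 < n.
   - If n <= 2, then ker G1 has codimension at most 2 and G1 + G2 <= r2 <= 2 on it.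
   - If n >= 3 and r2 = n, then G is complete bipartite, G1 G2 is the all-ones matrix
     and G1 + G2 <= r1 on the hyperplane orthogonal to the all-ones vector. *)
Require Import Defs.
From mathcomp Require Import all_boot all_order all_algebra all_field.
From mathcomp Require Import ring zify.
Set Implicit Arguments. Unset Strict Implicit. Unset Printing Implicit Defensive.
Import Order.TTheory GRing.Theory Num.Theory.
Local Open Scope ring_scope.
Local Open Scope sesquilinear_scope.

(** * Spectrum of a normal matrix *)

Lemma char_poly_similar (R : comUnitRingType) n (P A : 'M[R]_n) :
  P \in unitmx -> char_poly (invmx P *m A *m P) = char_poly A.
Proof.
move=> Pu; pose Q := map_mx (@polyC R) P; pose Q' := map_mx (@polyC R) (invmx P).
have QQ : Q' *m Q = 1%:M by rewrite /Q' /Q -map_mxM mulVmx // map_mx1.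
have -> : char_poly (invmx P *m A *m P) = \det (Q' *m char_poly_mx A *m Q).
  congr (\det _); rewrite /char_poly_mx mulmxBr mulmxBl !map_mxM.
  by rewrite (scalar_mxC _ Q') -(mulmxA _ Q') QQ mulmx1.

by rewrite !det_mulmx mulrAC -det_mulmx QQ det1 mul1r.
Qed.

(** [spectrum] is just some list of roots. Unitary diagonalization preserves the characteristic
    polynomial, and a product of monic linear factors determines its roots up to order. *)
Lemma perm_spectrum n (A : 'M[algC]_n) : A \is normalmx ->
  perm_eq (spectrum A) [seq spectral_diag A 0 i | i <- enum 'I_n].
Proof.
move=> /orthomx_spectralP An; rewrite /spectrum.
case: closed_field_poly_normal => s /=.
have /monicP -> := char_poly_monic A; rewrite scale1r => cA.
apply: prod_XsubC_eq; rewrite -cA {1}An char_poly_similar ?spectral_unit //.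
rewrite char_poly_trig ?diag_mx_is_trig // big_map big_enum.
by apply: eq_bigr => i _; rewrite mxE eqxx.
Qed.

(** * Hermitian forms *)

Definition qform n (A : 'M[algC]_n) (u : 'rV[algC]_n) : algC :=
  (u *m A *m u^t*) 0 0.

Lemma qformD n (A B : 'M[algC]_n) u : qform (A + B) u = qform A u + qform B u.
Proof. by rewrite /qform mulmxDr mulmxDl mxE. Qed.

Lemma qformB n (A B : 'M[algC]_n) u : qform (A - B) u = qform A u - qform B u.
Proof. by rewrite /qform mulmxBr mulmxBl !mxE. Qed.

Lemma qformZ n a (A : 'M[algC]_n) u : qform (a *: A) u = a * qform A u.
Proof. by rewrite /qform -scalemxAr -scalemxAl mxE. Qed.

Lemma qform_diag n (d u : 'rV[algC]_n) :
  qform (diag_mx d) u = \sum_i d 0 i * `|u 0 i| ^+ 2.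
Proof.
rewrite /qform mxE; apply: eq_bigr => i _.
by rewrite mul_mx_diag !mxE normCK mulrAC mulrC mulrA.
Qed.

Lemma qform1 n (u : 'rV[algC]_n) : qform 1%:M u = \sum_i `|u 0 i| ^+ 2.
Proof.
rewrite -diag_const_mx qform_diag.
by apply: eq_bigr => i _; rewrite mxE mul1r.
Qed.

Lemma qform1_ge0 n (u : 'rV[algC]_n) : 0 <= qform 1%:M u.
Proof. by rewrite qform1 sumr_ge0 // => i _; rewrite exprn_ge0. Qed.

Lemma qform_sym_sqr_ge0 n (A : 'M[algC]_n) u :
  A^t* = A -> 0 <= qform (A *m A) u.
Proof.
move=> Ah; have -> : qform (A *m A) u = qform 1%:M (u *m A).
  by rewrite /qform mulmx1 trmx_mul map_mxM Ah !mulmxA.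
exact: qform1_ge0.
Qed.

(** * The k-th largest eigenvalue *)

Lemma count_ge_nth_sort (s : seq algC) k :
  all (mem Num.real) s -> (k < size s)%N ->
  (k < count (fun x => nth 0 (sort (fun x y : algC => y <= x) s) k <= x)%R s)%N.
Proof.
set leT := (fun x y : algC => y <= x) => sR lt_k.
(* The order of [algC] is only partial; sorting is meaningful because all entries are real. *)
have tot : {in Num.real &, total leT} by move=> x y xR yR; rewrite /leT real_leVge.
have := sort_sorted_in tot sR; set t := sort leT s => t_sorted.
have st : perm_eq t s by rewrite perm_sort.
rewrite -(permP st); have lt_kt : (k < size t)%N by rewrite (perm_size st).
rewrite -[X in count _ X](cat_take_drop k.+1 t) count_cat ltn_addr //.
(* The first [k.+1] entries of the sorted list are all at least the entry at index [k]. *)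
suff /eqP -> : count (fun x => nth 0 t k <= x)%R (take k.+1 t) == size (take k.+1 t).
  by rewrite size_takel.
rewrite -all_count; apply/(all_nthP 0) => i.
rewrite size_takel // => lt_i; rewrite nth_take //.
have trans : transitive leT by move=> x y z yx zx; apply: le_trans zx yx.
have refl : reflexive leT by move=> x; apply: lexx.
apply: (sorted_leq_nth trans refl 0 t_sorted); rewrite ?inE //.
exact: leq_ltn_trans lt_kt.
Qed.

(* The upper-bound half of Courant-Fischer. *)
Lemma lambda_k_le n p (A : 'M[algC]_n) (W : 'M[algC]_(n, p)) k c :
  A \is hermsymmx -> (\rank W < k <= n)%N ->
  (forall u, u *m W = 0 -> qform A u <= c * qform 1%:M u) ->
  lambda_k A k <= c.
Proof.
move=> Ah /andP[ltWk le_kn] bound; set l := lambda_k A k.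
have An := hermitian_normalmx Ah.
have spR i : spectral_diag A 0 i \is Num.real.
  exact: (mxOverP (hermitian_spectral_diag_real Ah)).
have perm_sp := perm_spectrum An.
pose S := [set i | l <= spectral_diag A 0 i].
have ltWS : (\rank W < #|S|)%N.
  (* The k-th largest eigenvalue sits at index [k.-1]. The rank hypothesis excludes [k = 0], and
     [k <= n] keeps [nth] off its default value. *)
  case: k ltWk le_kn @l @S => // k ltWk lt_kn l S; apply: leq_trans ltWk _.
  have := @count_ge_nth_sort (spectrum A) k.
  rewrite (perm_all _ perm_sp) (perm_size perm_sp) size_map size_enum_ord.
  rewrite (permP perm_sp) count_map -sum1_count big_enum_cond /= => /(_ _ lt_kn).
  have -> : (#|S| = \sum_(i < n | (l <= spectral_diag A 0 i)%R) 1)%N.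
    by rewrite -sum1_card; apply: eq_bigl => i; rewrite inE.
  by apply; apply/allP => _ /mapP[i _ ->]; apply: spR.
(* The rows of [PS] are orthonormal eigenvectors for the eigenvalues that are at least [l]. *)
set P := spectralmx A; pose PS := rowsub (@enum_val _ (mem S)) P.
have PSu : PS *m PS^t* = 1%:M.
  have /unitarymxP PP := spectral_unitarymx A.
  apply/matrixP => i j; have /matrixP/(_ (enum_val i) (enum_val j)) := PP.
  rewrite !mxE (inj_eq enum_val_inj) => <-.
  by apply: eq_bigr => h _; rewrite !mxE.
have PSA : PS *m A = diag_mx (colsub (@enum_val _ (mem S)) (spectral_diag A)) *m PS.
  have : P *m A = diag_mx (spectral_diag A) *m P.
    by rewrite {1}(orthomx_spectralP An) !mulmxA mulmxV ?spectral_unit // mul1mx.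
  move=> /(congr1 (rowsub (@enum_val _ (mem S)))).
  rewrite mul_rowsub_mx => ->; apply/matrixP => i j.
  by rewrite !mul_diag_mx !mxE.
(* There are more such eigenvectors than the rank of [W], so a nontrivial combination of them is
   killed by [W]. *)
have /rowV0Pn[a /sub_kermxP a0 a_neq0] : kermx (PS *m W) != 0.
  rewrite -mxrank_eq0 mxrank_ker -lt0n subn_gt0.
  exact: leq_ltn_trans (mxrankM_maxr _ _) ltWS.
have := bound (a *m PS); rewrite -mulmxA => /(_ a0).
have q1 : qform 1%:M (a *m PS) = qform 1%:M a.
  by rewrite /qform trmx_mul map_mxM !mulmx1 !mulmxA -(mulmxA a) PSu mulmx1.
have -> : qform A (a *m PS) =
    qform (diag_mx (colsub (@enum_val _ (mem S)) (spectral_diag A))) a.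
  rewrite /qform trmx_mul map_mxM -(mulmxA a) PSA !mulmxA.
  by rewrite -(mulmxA _ PS) PSu mulmx1.
rewrite q1 => le_c; have : 0 < qform 1%:M a.
  rewrite lt_def qform1_ge0 andbT qform1; apply: contra a_neq0 => /eqP sum0.
  apply/eqP/rowP => i; rewrite mxE; apply/eqP; rewrite -normr_eq0 -sqrf_eq0.
  by apply/eqP; apply: (psumr_eq0P _ sum0) => // j _; rewrite exprn_ge0.
move=> /ler_pM2r <-; apply: le_trans le_c.
rewrite qform1 qform_diag mulr_sumr ler_sum // => i _.
rewrite ler_wpM2r ?exprn_ge0 // mxE.
by have := enum_valP i; rewrite inE.
Qed.

(** * Forms of multiples of projections *)

Lemma qform_idem_le n (G : 'M[algC]_n) r u :
  G^t* = G -> G *m G = r *: G -> 0 < r -> qform G u <= r * qform 1%:M u.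
Proof.
move=> Gh GG r_gt0; rewrite -subr_ge0 -(pmulr_rge0 _ r_gt0).
(* The matrix [r%:M - G] is Hermitian and its square is [r] times itself, so its form is
   nonnegative. *)
have : (r%:M - G)^t* = r%:M - G.
  rewrite linearB map_mxB /= Gh tr_scalar_mx map_scalar_mx /=.
  by rewrite conj_Creal // gtr0_real.
move=> /(qform_sym_sqr_ge0 u); congr (_ <= _).
rewrite mulmxBr !mulmxBl GG !mul_scalar_mx mul_mx_scalar subrr subr0.
by rewrite qformB !qformZ -scalemx1 qformZ; ring.
Qed.

(* On vectors where [G1 G2] and [G2 G1] vanish, [G1 / r1] and [G2 / r2] act as
   orthogonal projections with orthogonal ranges, so their forms add up to at
   most the identity. *)
Lemma qform_orth_idem_le n (G1 G2 : 'M[algC]_n) r1 r2 u :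
  G1^t* = G1 -> G2^t* = G2 -> G1 *m G1 = r1 *: G1 -> G2 *m G2 = r2 *: G2 ->
  0 < r2 <= r1 -> qform (G1 *m G2) u = 0 -> qform (G2 *m G1) u = 0 ->
  qform (G1 + G2) u <= r1 * qform 1%:M u.
Proof.
move=> G1h G2h GG1 GG2 /andP[r2_gt0 le_r] q12 q21.
have r1_gt0 : 0 < r1 by apply: lt_le_trans le_r.
pose X := (1%:M - r1^-1 *: G1) - r2^-1 *: G2.
have Xh : X^t* = X.
  rewrite /X !linearB !map_mxB /= !linearZ !map_mxZ /= G1h G2h.
  rewrite tr_scalar_mx map_scalar_mx /= rmorph1.
  by rewrite !scalerN !conj_Creal // gtr0_real ?invr_gt0.
have q2_ge0 : 0 <= qform G2 u.
  have := qform_sym_sqr_ge0 u G2h; rewrite GG2 qformZ.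
  by rewrite pmulr_rge0.
have := qform_sym_sqr_ge0 u Xh.
have -> : qform (X *m X) u = qform 1%:M u - r1^-1 * qform G1 u - r2^-1 * qform G2 u.
  rewrite /X !mulmxBr !mulmxBl !mul1mx !mulmx1 -!scalemxAl -!scalemxAr GG1 GG2.
  rewrite !(qformB, qformZ) q12 q21; field.
  by rewrite !gt_eqF.
rewrite -(pmulr_rge0 _ r1_gt0) => q_ge0; rewrite qformD -subr_ge0.
(* The second summand is the slack from replacing [r2] by the larger [r1]. *)
have -> : r1 * qform 1%:M u - (qform G1 u + qform G2 u) =
    r1 * (qform 1%:M u - r1^-1 * qform G1 u - r2^-1 * qform G2 u) +
    (r1 - r2) / r2 * qform G2 u.
  by field; rewrite !gt_eqF.
by rewrite addr_ge0 // mulr_ge0 // divr_ge0 ?subr_ge0 // ltW.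
Qed.

(** * Incidence and Gram matrices of the two sides *)

Definition incidence (T : finType) (e : rel T) (S : {set T}) :
    'M[algC]_(#|edges e|, #|S|) :=
  \matrix_(i, j) ((enum_val j : T) \in (enum_val i : {set T}))%:R.

Definition gram (T : finType) (e : rel T) (S : {set T}) : 'M[algC]_#|edges e| :=
  incidence e S *m (incidence e S)^T.

Definition side (T : finType) (e : rel T) (S : {set T}) : Prop :=
  forall x y, e x y -> (x \in S) != (y \in S).

Section Side.

Variables (T : finType) (e : rel T).
Hypothesis e_simple : simple_graph e.

Lemma edgesP (A : {set T}) :
  reflect (exists x y, e x y /\ A = [set x; y]) (A \in edges e).
Proof.
rewrite inE; apply: (iffP existsP) => [[x /existsP[y /andP[exy /eqP->]]]|].
  by exists x, y.
by move=> [x [y [exy ->]]]; exists x; apply/existsP; exists y; rewrite exy eqxx.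
Qed.

Lemma mem_edgeE A x : A \in edges e -> x \in A -> exists2 y, e x y & A = [set x; y].
Proof.
have [e_sym _] := e_simple.
move=> /edgesP[y [z [eyz ->]]]; rewrite in_set2 => /orP[]/eqP->.
  by exists z.
by exists y; rewrite 1?e_sym // setUC.
Qed.

Lemma edges_at x : [set A in edges e | x \in A] = [set [set x; y] | y in nbhd e x].
Proof.
apply/setP => A; rewrite inE; apply/andP/imsetP => [[Ae xA]|[y]].
  by have [y exy ->] := mem_edgeE Ae xA; exists y => //; rewrite inE.
by rewrite inE => exy ->; rewrite set21; split => //; apply/edgesP; exists x, y.
Qed.

Lemma card_edges_at x : #|[set A in edges e | x \in A]| = deg e x.
Proof.
have [_ e_irr] := e_simple.
rewrite edges_at card_in_imset // => y z; rewrite !inE => exy exz /setP/(_ y).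
rewrite !inE eqxx orbT; case: (eqVneq y x) exy => [->|_ _ /esym/eqP //].
by rewrite e_irr.
Qed.

Lemma card_edge A : A \in edges e -> #|A| = 2%N.
Proof.
have [_ e_irr] := e_simple.
move=> /edgesP[x [y [exy ->]]]; rewrite cards2.
by case: eqVneq exy => // ->; rewrite e_irr.
Qed.

Lemma gramE S i j :
  gram e S i j = #|S :&: (enum_val i :&: enum_val j)|%:R.
Proof.
rewrite mxE (eq_bigr (fun k : 'I_#|S| =>
  (((enum_val k : T) \in (enum_val i : {set T})) &&
   ((enum_val k : T) \in (enum_val j : {set T})))%:R)); last first.
  by move=> k _; rewrite !mxE -natrM mulnb.
rewrite -(big_enum_val (fun x => ((x \in enum_val i) && (x \in enum_val j))%:R)) /=.
rewrite -natr_sum -big_mkcondr /= -sum1_card; congr _%:R.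
by apply: eq_bigl => x; rewrite !inE.
Qed.

Lemma gram_hermitian S : (gram e S)^t* = gram e S.
Proof.
by apply/matrixP => i j; rewrite 2!mxE !gramE rmorph_nat [X in S :&: X]setIC.
Qed.

Lemma sideC S : side e S -> side e (~: S).
Proof. by move=> eS x y /eS; rewrite !inE; case: (x \in S); case: (y \in S). Qed.

Lemma card_edge_side S A : side e S -> A \in edges e -> #|S :&: A| = 1%N.
Proof.
move=> eS /edgesP[x [y [/eS xyS ->]]]; rewrite setIUr cardsU.
rewrite -[in X in (_ - X)%N]setIIr.
have -> : S :&: ([set x] :&: [set y]) = set0.
  apply/setP => z; rewrite !inE; case: eqP => [->|]; last by rewrite andbF.
  by case: (x =P y) xyS => [->|]; rewrite ?eqxx ?andbF.
have cS z : #|S :&: [set z]| = (z \in S).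
  case: (boolP (z \in S)) => zS; first by rewrite (setIidPr _) ?sub1set ?cards1.
  by apply/eqP; rewrite cards_eq0 setI_eq0 disjoint_sym disjoints1.
by rewrite !cS cards0; case: (x \in S) (y \in S) xyS => [] [].
Qed.

Lemma incidence_trmulE S1 S2 v w :
  ((incidence e S1)^T *m incidence e S2) v w =
  #|[set A in edges e | (enum_val v \in A) && (enum_val w \in A)]|%:R.
Proof.
rewrite mxE (eq_bigr (fun k : 'I_#|edges e| =>
  ((enum_val v \in (enum_val k : {set T})) &&
   (enum_val w \in (enum_val k : {set T})))%:R)); last first.
  by move=> k _; rewrite !mxE -natrM mulnb.
rewrite -(big_enum_val
  (fun A : {set T} => ((enum_val v \in A) && (enum_val w \in A))%:R)) /=.
rewrite -natr_sum -big_mkcondr /= -sum1_card; congr _%:R.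
by apply: eq_bigl => A; rewrite !inE.
Qed.

(** An edge meets a side in exactly one vertex, so the columns for distinct vertices have disjoint
    supports; the diagonal entries are degrees. *)
Lemma incidence_trmul S r : side e S -> {in S, forall x, deg e x = r} ->
  (incidence e S)^T *m incidence e S = r%:R%:M.
Proof.
move=> eS degS; apply/matrixP => v w; rewrite incidence_trmulE mxE.
case: eqVneq => [<-|neq_vw].
  rewrite mulr1n -(degS _ (enum_valP v)) -card_edges_at //; congr _%:R.
  by apply: eq_card => A; rewrite !inE andbb.
rewrite mulr0n; apply/eqP; rewrite pnatr_eq0 cards_eq0 -subset0.
apply/subsetP => A; rewrite inE => /and3P[Ae vA wA].
have /eqP/cards1P[x SA] := card_edge_side eS Ae.
have := enum_valP v; have := enum_valP w; move: neq_vw; rewrite -(inj_eq enum_val_inj).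
move=> neq_vw wS vS.
have : enum_val v \in S :&: A by rewrite inE vS.
have : enum_val w \in S :&: A by rewrite inE wS.
by rewrite SA !inE => /eqP xw /eqP xv; rewrite xw xv eqxx in neq_vw.
Qed.

Lemma gram_sqr S r : side e S -> {in S, forall x, deg e x = r} ->
  gram e S *m gram e S = r%:R *: gram e S.
Proof.
move=> eS degS; rewrite /gram mulmxA -(mulmxA (incidence e S)).
by rewrite (incidence_trmul eS degS) mul_mx_scalar -scalemxAl.
Qed.

Lemma line_adj_gram S : line_adj e = gram e S + gram e (~: S) - 2%:R%:M.
Proof.
apply/matrixP => i j; rewrite [RHS]mxE [X in _ = X + _]mxE !gramE !mxE.
rewrite -natrD ![_ :&: (_ :&: enum_val j)]setIC -setDE cardsID.
have Ei := enum_valP i; have Ej := enum_valP j.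
case: eqVneq => [<-|neq_ij]; first by rewrite setIid card_edge // subrr.
rewrite subr0 /=; congr _%:R; rewrite -card_gt0.
(* Distinct two-element sets share at most one element, so the 0/1 entry of [line_adj] equals the
   number of common endpoints. *)
have : (#|enum_val i :&: enum_val j| < 2)%N.
  rewrite -(card_edge Ei); apply/proper_card/properIl.
  apply: contra neq_ij => sub_ij; rewrite -(inj_eq enum_val_inj).
  by rewrite eqEcard sub_ij !card_edge.
by case: #|_| => [|[]].
Qed.

(** Double counting of incidences: each edge has one endpoint in [S], and each vertex of [S] lies on
    [r] edges. *)
Lemma card_edges S r : side e S -> {in S, forall x, deg e x = r} ->
  #|edges e| = (#|S| * r)%N.
Proof.
move=> eS degS; rewrite -sum_nat_const.
rewrite -(eq_bigr _ degS) -sum1_card.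
have -> : (\sum_(A in edges e) 1 = \sum_(A in edges e) \sum_(x in S | x \in A) 1)%N.
  apply: eq_bigr => A Ae; rewrite -[LHS](card_edge_side eS Ae) -sum1_card.
  by apply: eq_bigl => x; rewrite inE.
rewrite (exchange_big_dep (mem S)) /= => [|A x _ /andP[] //].
apply: eq_bigr => x xS; rewrite -card_edges_at // -sum1_card.
by apply: eq_bigl => A; rewrite inE xS.
Qed.

(** The inner product of the two incidence matrices is all ones, since exactly one edge joins each
    pair across the sides. The outer factors then contribute row sums, which are 1. *)
Lemma gram_mul_complete S : side e S -> {in S & ~: S, forall x y, e x y} ->
  gram e S *m gram e (~: S) = const_mx 1.
Proof.
move=> eS eSS; rewrite /gram mulmxA -(mulmxA (incidence e S)).
have -> : (incidence e S)^T *m incidence e (~: S) = const_mx 1.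
  apply/matrixP => v w; rewrite incidence_trmulE mxE.
  have evw := eSS _ _ (enum_valP v) (enum_valP w).
  rewrite -[RHS]/(1%:R); congr _%:R; apply/eqP/cards1P; exists [set enum_val v; enum_val w].
  have E : [set enum_val v; enum_val w] \in edges e.
    by apply/edgesP; exists (enum_val v), (enum_val w).
  apply/setP => A; rewrite in_set in_set1.
  apply/idP/eqP => [/and3P[Ae vA wA]|->].
    by apply/esym/eqP; rewrite eqEcard subUset !sub1set vA wA !card_edge.
  by rewrite E set21 set22.
have row1 S' (i : 'I_#|edges e|) : side e S' -> \sum_k incidence e S' i k = 1.
  move=> eS'; rewrite (eq_bigr (fun k : 'I_#|S'| =>
    ((enum_val k : T) \in (enum_val i : {set T}))%:R)); last by move=> k _; rewrite mxE.
  rewrite -(big_enum_val (fun x => (x \in (enum_val i : {set T}))%:R)) /=.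
  rewrite -natr_sum -big_mkcondr /= sum1_card.
  rewrite -[RHS]/(1%:R) -(card_edge_side eS' (enum_valP i)); congr _%:R.
  by apply: eq_card => x; rewrite !inE.
apply/matrixP => i j; rewrite !mxE (eq_bigr (fun k => incidence e (~: S) j k)).
  by rewrite row1 //; apply: sideC.
move=> k _; rewrite !mxE (eq_bigr (fun h => incidence e S i h)) ?row1 ?mul1r //.
by move=> h _; rewrite [X in _ * X]mxE mulr1.
Qed.

(** * The third eigenvalue of the line graph *)

Lemma line_adj_hermitian : line_adj e \is hermsymmx.
Proof.
(* The Gram decomposition holds for every vertex set; [set0] is an arbitrary choice. *)
apply/is_hermitianmxP; rewrite expr0 scale1r (line_adj_gram set0).
rewrite linearB map_mxB linearD map_mxD /= !gram_hermitian.
by rewrite tr_scalar_mx map_scalar_mx /= conj_Creal ?realn.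
Qed.

(** Common frame of the three cases: the kernel of [W] is the test subspace, and the arithmetic
    hypothesis is [r - 2 <= m / 3] cleared of denominators and of subtraction, with [m] the number
    of edges. *)
Lemma lambda3_line_adj_le S p (W : 'M_(#|edges e|, p)) r :
  (\rank W < 3 <= #|edges e|)%N -> (3 * r <= #|edges e| + 6)%N ->
  (forall u, u *m W = 0 ->
     qform (gram e S + gram e (~: S)) u <= r%:R * qform 1%:M u) ->
  lambda_k (line_adj e) 3 <= #|edges e|%:R / 3%:R.
Proof.
move=> rkW le_r bound.
apply: (@le_trans _ _ (r%:R - 2%:R)); last first.
  rewrite ler_pdivlMr ?ltr0n // mulrBl lerBlDr -!natrM -natrD ler_nat.
  by rewrite mulnC.
apply: (lambda_k_le line_adj_hermitian rkW) => u /bound.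
move=> le_u; rewrite (line_adj_gram S) qformB -(scalemx1 _ 2%:R) qformZ mulrBl.
by rewrite lerD2r.
Qed.

Lemma lambda3_line_adj_semiregular S r1 r2 :
  side e S -> {in S, forall x, deg e x = r1} -> {in ~: S, forall x, deg e x = r2} ->
  (r2 <= r1)%N -> (3 <= #|edges e|)%N ->
  lambda_k (line_adj e) 3 <= #|edges e|%:R / 3%:R.
Proof.
move=> eS deg1 deg2 le_r21 m_ge3; have eS' := sideC eS.
have m1 := card_edges eS deg1; have m2 := card_edges eS' deg2.
have nbhdS x : x \in ~: S -> nbhd e x \subset S.
  move=> xS; apply/subsetP => y; rewrite inE => /eS.
  by move: xS; rewrite inE => /negPf->; case: (y \in S).
have [y yS] : exists y, y \in ~: S.
  by apply/set0Pn; rewrite -cards_eq0; move: m_ge3; rewrite m2; case: #|_|.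
have le_r2n : (r2 <= #|S|)%N by rewrite -(deg2 _ yS) subset_leq_card ?nbhdS.
have r2_gt0 : (0 < r2)%N by move: m_ge3; rewrite m2; case: (r2); rewrite ?muln0.
have r1_gt0 : (0 < r1)%N by apply: leq_trans le_r21.
have q1 u : qform (gram e S) u <= r1%:R * qform 1%:M u.
  by apply: qform_idem_le (gram_hermitian S) (gram_sqr eS deg1) _; rewrite ltr0n.
have q2 u : qform (gram e (~: S)) u <= r2%:R * qform 1%:M u.
  by apply: qform_idem_le (gram_hermitian _) (gram_sqr eS' deg2) _; rewrite ltr0n.
have [S_le2|S_gt2] := leqP #|S| 2.
  apply: (@lambda3_line_adj_le S _ (incidence e S) r2) => // [||u uB].
  - by rewrite m_ge3 andbT ltnS (leq_trans (rank_leq_col _)).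
  (* Here [r2 <= #|S| <= 2], so [3 * r2 <= 6]. *)
  - by lia.
  - by rewrite qformD {1}/qform /gram mulmxA uB !mul0mx mxE add0r q2.
have [r2E|r2_neq] := eqVneq r2 #|S|; last first.
  (* A matrix without columns imposes no constraint: the bound holds on the whole space. *)
  apply: (@lambda3_line_adj_le S 0 0 (r1 + r2)) => // [||u _].
  - by rewrite mxrank0.
  - have {}r2_neq : (r2 < #|S|)%N by rewrite ltn_neqAle r2_neq.
    (* From 6 vertices on, [3 * (r1 + r2) <= 6 * r1] suffices. Sizes 3, 4 and 5 are checked one by
       one, where the inequality becomes linear. *)
    have [n6|n6] := leqP 6 #|S|; rewrite m1; first by nia.
    by move: S_gt2 r2_neq n6; move: #|S| => [|[|[|[|[|[|n]]]]]]; lia.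
  - by rewrite qformD natrD mulrDl lerD.
have complete : {in S & ~: S, forall x y, e x y}.
  move=> x z xS zS; have [e_sym _] := e_simple.
  (* A vertex outside [S] has all its [r2 = #|S|] neighbours in [S], hence is adjacent to all of
     [S]. *)
  have : nbhd e z == S by rewrite eqEcard nbhdS // -r2E -(deg2 _ zS) leqnn.
  by move=> /eqP/setP/(_ x); rewrite xS inE e_sym.
have G12 := gram_mul_complete eS complete.
have G21 : gram e (~: S) *m gram e S = const_mx 1.
  have := gram_mul_complete eS'; rewrite setCK; apply => x z xS zS.
  by have [e_sym _] := e_simple; rewrite e_sym complete.
apply: (@lambda3_line_adj_le S 1 (const_mx 1) r1) => // [||u u1].
- by rewrite m_ge3 andbT ltnS (leq_trans (rank_leq_col _)).
- by rewrite m1; nia.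
(* The all-ones matrix factors through the all-ones column, which [u] annihilates. *)
have qJ : qform (const_mx 1) u = 0.
  rewrite /qform (_ : const_mx 1 = (const_mx 1 : 'cV_(_)) *m (const_mx 1 : 'rV_(_))).
    by rewrite mulmxA u1 !mul0mx mxE.
  by apply/matrixP => i j; rewrite !mxE big_ord1 !mxE mulr1.
apply: (qform_orth_idem_le (r2 := r2%:R)); rewrite ?gram_hermitian ?G12 ?G21 //.
- exact: gram_sqr.
- exact: gram_sqr.
- by rewrite ltr0n r2_gt0 ler_nat.
Qed.

End Side.

Unset Implicit Arguments.

Theorem theorem3p4 (T : finType) (e : rel T) :
  simple_graph e ->
  semiregular_bipartite e ->
  (3 <= #|edges e|)%N ->
  lambda_k (line_adj e) 3 <= (#|edges e|)%:R / 3%:R.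
Proof.
move=> e_simple [S [r1 [r2 [eS deg1 deg2]]]] m_ge3.
have deg2' : {in ~: S, forall x, deg e x = r2} by move=> x; rewrite inE => /deg2.
have [le_r21|/ltnW le_r12] := leqP r2 r1.
  exact: (lambda3_line_adj_semiregular e_simple eS deg1 deg2').
(* Swapping the sides puts the larger degree first. *)
apply: (lambda3_line_adj_semiregular e_simple (sideC eS) deg2' _ le_r12 m_ge3).
by rewrite setCK.
Qed.
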